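(* Let $\mathcal{X}=[0,1]^d$, let $k$ be a squared-exponential kernel $k(x,y)=\exp(-\|x-y\|^2/(2\ell^2))$, and $\mathcal{B}_k=\{f\in\mathcal{H}_k:\|f\|_{\mathcal{H}_k}\le B\}$. Run Algorithm 5 with a fixed point set $X_{T-1}=\{x_1,\dots,x_{T-1}\}\subset\mathcal{X}$ of fill distance $h_X$. Then there exists a constant $c>0$ such that, whenever $h_X$ is sufficiently small, $\widetilde r_T\le B\exp\!\big(c\log(h_X)/(2\sqrt{h_X})\big)$.
   Context: Algorithm 5: given $f_1,\dots,f_{T-1}\in\mathcal{B}_k$, observe $f_i(x_i)$ for $i\le T-1$; form $m_{T-1}(x)=\mathbf{k}_{T-1}(x)^T\mathbf{K}_{T-1}^{-1}\mathbf{y}$ with $\mathbf{y}=[f_i(x_i)]_{i<T}$ and $\sigma_{T-1}^2(x)=k(x,x)-\mathbf{k}_{T-1}(x)^T\mathbf{K}_{T-1}^{-1}\mathbf{k}_{T-1}(x)$, where $\mathbf{k}_{T-1}(x)=[k(x,x_i)]_{i<T}$, $\mathbf{K}_{T-1}=[k(x_i,x_j)]_{i,j<T}$; choose $x_T\in\arg\max_{x\in\mathcal{X}}m_{T-1}(x)+B\sigma_{T-1}(x)$. Simple adversarial regret: $\widetilde r_T=\min_{t\in[T]}\sup\{\max_{x\in\mathcal{X}}f_t(x)-f_t(x_t):\ f_t\in\mathcal{B}_k,\ f_t(x_i)=f_i(x_i)\ \forall i\in[t-1]\}$. Fill distance: $h_X=\sup_{x\in\mathcal{X}}\min_{x_t\in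 X}\|x-x_t\|$. *)

(* Defs.v *)
From Stdlib Require Import Reals Lra Lia Arith.
Open Scope R_scope.

(* Points of R^d are encoded as functions nat -> R; the cube [0,1]^d consists
   of those with coordinates i < d in [0,1] and all coordinates i >= d equal 0. *)
Definition point := nat -> R.

Fixpoint rsum (n : nat) (f : nat -> R) : R :=
  match n with O => 0 | S m => rsum m f + f m end.

Definition sqdist (d : nat) (x y : point) : R := rsum d (fun i => (x i - y i) ^ 2).
Definition edist (d : nat) (x y : point) : R := sqrt (sqdist d x y).

Definition in_cube (d : nat) (x : point) : Prop :=
  (forall i, (i < d)%nat -> 0 <= x i <= 1) /\ (forall i, (d <= i)%nat -> x i = 0).

Definition se_kernel (d : nat) (l : R) (x y : point) : R :=
  exp (- sqdist d x y / (2 * l ^ 2)).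

(* Pre-Hilbert space of the RKHS: finite combinations sum_i a_i k(p_i, .) *)
Record comb := mkComb { csize : nat; ccoef : nat -> R; cpt : nat -> point }.

Definition comb_eval (k : point -> point -> R) (g : comb) (x : point) : R :=
  rsum (csize g) (fun i => ccoef g i * k (cpt g i) x).

Definition comb_ip (k : point -> point -> R) (g h : comb) : R :=
  rsum (csize g) (fun i => rsum (csize h)
    (fun j => ccoef g i * ccoef h j * k (cpt g i) (cpt h j))).

Definition comb_dist2 (k : point -> point -> R) (g h : comb) : R :=
  comb_ip k g g - 2 * comb_ip k g h + comb_ip k h h.

(* f : X -> R lies in B_k = {f in H_k : ||f||_{H_k} <= B}, where H_k on
   X = [0,1]^d is the (Moore-Aronszajn) completion of the pre-Hilbert space:
   f is the pointwise limit on X of a Cauchy sequence G_n of finite kernel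
   combinations (centres in X), and ||f||_{H_k} = lim ||G_n|| <= B. *)
Definition in_ball_RKHS (d : nat) (k : point -> point -> R) (B : R) (f : point -> R) : Prop :=
  exists G : nat -> comb,
    (forall n i, (i < csize (G n))%nat -> in_cube d (cpt (G n) i)) /\
    (forall eps, eps > 0 -> exists N, forall n m, (N <= n)%nat -> (N <= m)%nat ->
        comb_dist2 k (G n) (G m) < eps) /\
    (forall x, in_cube d x -> Un_cv (fun n => comb_eval k (G n) x) (f x)) /\
    (forall eps, eps > 0 -> exists N, forall n, (N <= n)%nat ->
        sqrt (comb_ip k (G n) (G n)) <= B + eps).

(* GP posterior mean m(z) = k(z)^T K^{-1} y, with points x_0..x_{n-1}:
   m(z) = sum_j k(z,x_j) alpha_j where K alpha = y. *)
Definition post_mean (k : point -> point -> R) (n : nat) (x : nat -> point)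
    (y : nat -> R) (m : point -> R) : Prop :=
  exists alpha : nat -> R,
    (forall i, (i < n)%nat -> rsum n (fun j => k (x i) (x j) * alpha j) = y i) /\
    (forall z, m z = rsum n (fun j => k z (x j) * alpha j)).

(* GP posterior variance s2(z) = k(z,z) - k(z)^T K^{-1} k(z):
   with K beta = k(z), s2(z) = k(z,z) - sum_j k(z,x_j) beta_j. *)
Definition post_var (k : point -> point -> R) (n : nat) (x : nat -> point)
    (s2 : point -> R) : Prop :=
  forall z, exists beta : nat -> R,
    (forall i, (i < n)%nat -> rsum n (fun j => k (x i) (x j) * beta j) = k z (x i)) /\
    s2 z = k z z - rsum n (fun j => k z (x j) * beta j).

Definition is_fill_distance (d n : nat) (x : nat -> point) (h : R) : Prop :=
  is_lub (fun r => exists z, in_cube d z /\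
             (exists i, (i < n)%nat /\ r = edist d z (x i)) /\
             (forall i, (i < n)%nat -> r <= edist d z (x i))) h.

(* "simple adversarial regret  r~_T <= R", T = n+1, with queried points
   x_0..x_{n-1} (the fixed set X_{T-1}) and x_T = xT; observations f_i(x_i).
   min_{t in [T]} sup { max_z g z - g(x_t) : g in B_k, g(x_i) = f_i(x_i), i < t } <= R
   unfolded: some t has every element of its sup-set <= R. *)
Definition simple_regret_le (d : nat) (k : point -> point -> R) (B : R) (n : nat)
    (x : nat -> point) (f : nat -> point -> R) (xT : point) (R0 : R) : Prop :=
  exists t, (t <= n)%nat /\
    forall g, in_ball_RKHS d k B g ->
      (forall i, (i < t)%nat -> g (x i) = f i (x i)) ->
      forall z, in_cube d z ->
        g z - g (if Nat.ltb t n then x t else xT) <= R0.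

(* Main.v *)
(* An interpolant of the data in the ball of radius B differs from the posterior mean by at
   most B sigma (Cauchy-Schwarz in the RKHS), so the choice of x_T bounds the regret at T by
   2 B sigma(x_T). Moreover sigma(x_T)^2 is both the squared norm and the value at x_T of the
   residual e of k(x_T, .), which vanishes at all data points. Up to the factor
   exp(-|y|^2 / (2 l^2)), e is the sum of its degree-n Taylor polynomial P and of a tail of
   size sigma tau_n^(1/2) with tau_n of order n^(-n). By Bernstein's inequality for
   cosine polynomials, P moves by O(n h^(1/2)) sup|P| between a point and its nearest data
   point, so for n of order h^(-1/2) it is controlled by its values at the data points, which
   are of the size of the tail. Hence sigma^2 <= 9 tau_n. *)
Require Import Defs.
From Stdlib Require Import Reals Lra Lia ZArith.
Open Scope R_scope.

(** * Finite sums and limits of real sequences *)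

Lemma rsum_ext n f g : (forall i, (i < n)%nat -> f i = g i) -> rsum n f = rsum n g.
Proof.
  induction n as [|n IH]; simpl; intros H; [reflexivity|].
  rewrite IH by (intros; apply H; lia). rewrite H by lia. reflexivity.
Qed.

Lemma rsum_plus n f g : rsum n (fun i => f i + g i) = rsum n f + rsum n g.
Proof. induction n as [|n IH]; simpl; [lra|rewrite IH; lra]. Qed.

Lemma rsum_scal n a f : rsum n (fun i => a * f i) = a * rsum n f.
Proof. induction n as [|n IH]; simpl; [lra|rewrite IH; lra]. Qed.

Lemma rsum_le n f g : (forall i, (i < n)%nat -> f i <= g i) -> rsum n f <= rsum n g.
Proof.
  induction n as [|n IH]; simpl; intros H; [lra|].
  apply Rplus_le_compat; [apply IH; intros; apply H; lia|apply H; lia].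
Qed.

Lemma rsum_const n a : rsum n (fun _ => a) = INR n * a.
Proof. induction n as [|n IH]; [simpl; lra|]. rewrite S_INR. simpl. rewrite IH. lra. Qed.

Lemma rsum_nonneg n f : (forall i, (i < n)%nat -> 0 <= f i) -> 0 <= rsum n f.
Proof.
  intros H. replace 0 with (rsum n (fun _ => 0)) by (rewrite rsum_const; lra).
  now apply rsum_le.
Qed.

Lemma rsum_term_le n f i :
  (forall j, (j < n)%nat -> 0 <= f j) -> (i < n)%nat -> f i <= rsum n f.
Proof.
  induction n as [|n IH]; simpl; intros H Hi; [lia|].
  destruct (Nat.eq_dec i n) as [->|Hne].
  - assert (0 <= rsum n f) by (apply rsum_nonneg; intros; apply H; lia). lra.
  - assert (f i <= rsum n f) by (apply IH; [intros; apply H; lia|lia]).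
    assert (0 <= f n) by (apply H; lia). lra.
Qed.

Lemma rsum_abs n f : Rabs (rsum n f) <= rsum n (fun i => Rabs (f i)).
Proof.
  induction n as [|n IH]; simpl; [rewrite Rabs_R0; lra|].
  eapply Rle_trans; [apply Rabs_triang|lra].
Qed.

Lemma rsum_exchange n m (f : nat -> nat -> R) :
  rsum n (fun i => rsum m (fun j => f i j)) = rsum m (fun j => rsum n (fun i => f i j)).
Proof.
  induction n as [|n IH]; simpl.
  - rewrite rsum_const. lra.
  - rewrite IH, <- rsum_plus. reflexivity.
Qed.

Lemma rsum_split n m f : rsum (n + m) f = rsum n f + rsum m (fun i => f (n + i)%nat).
Proof.
  induction m as [|m IH]; simpl; [rewrite Nat.add_0_r; lra|].
  rewrite Nat.add_succ_r. simpl. rewrite IH. lra.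
Qed.

Lemma rsum_tele n f : rsum n (fun i => f (S i) - f i) = f n - f O.
Proof. induction n as [|n IH]; simpl; [lra|rewrite IH; lra]. Qed.

Lemma rsum_cv n (F : nat -> nat -> R) (L : nat -> R) :
  (forall i, (i < n)%nat -> Un_cv (fun N => F N i) (L i)) ->
  Un_cv (fun N => rsum n (F N)) (rsum n L).
Proof.
  induction n as [|n IH]; simpl; intros H.
  - intros eps He. exists O. intros. unfold Rdist. rewrite Rminus_diag, Rabs_R0. lra.
  - apply (CV_plus (fun N => rsum n (F N)) (fun N => F N n));
      [apply IH; intros; apply H; lia|apply H; lia].
Qed.

Lemma Un_cv_const a : Un_cv (fun _ => a) a.
Proof. intros eps He. exists O. intros. unfold Rdist. rewrite Rminus_diag, Rabs_R0. lra. Qed.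

Lemma Un_cv_ext (u v : nat -> R) l : (forall n, u n = v n) -> Un_cv u l -> Un_cv v l.
Proof. intros E H eps He. destruct (H eps He) as [N HN]. exists N. intros. rewrite <- E. auto. Qed.

Lemma Un_cv_ge a (u : nat -> R) l N0 :
  Un_cv u l -> (forall n, (N0 <= n)%nat -> a <= u n) -> a <= l.
Proof.
  intros H Hu. apply Rnot_lt_le. intros Hlt.
  destruct (H (a - l) ltac:(lra)) as [N HN].
  specialize (HN (Nat.max N N0) ltac:(lia)). specialize (Hu (Nat.max N N0) ltac:(lia)).
  unfold Rdist in HN. apply Rabs_def2 in HN. lra.
Qed.

(** * Bernstein's inequality *)

(** For [j < n], the zeros of cos(n t) in (0, PI): the nodes of M. Riesz's interpolation formula for
    the derivative. *)
Definition riesz_node (n j : nat) : R := (2 * INR j + 1) * (PI / (2 * INR n)).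

(** Telescopes, since 2 sin a cos((2j+1) a) = sin((2j+2) a) - sin(2j a). *)
Lemma dirichlet_sum N a :
  2 * sin a * rsum N (fun j => cos ((2 * INR j + 1) * a)) = sin (2 * INR N * a).
Proof.
  induction N as [|N IH].
  - simpl. rewrite !Rmult_0_r, Rmult_0_l, sin_0. reflexivity.
  - cbn [rsum]. rewrite Rmult_plus_distr_l, IH, S_INR.
    replace (2 * INR N * a) with ((2 * INR N + 1) * a - a) by ring.
    replace (2 * (INR N + 1) * a) with ((2 * INR N + 1) * a + a) by ring.
    rewrite sin_minus, sin_plus. ring.
Qed.

Lemma riesz_node_bounds n j : (j < n)%nat -> 0 < riesz_node n j < PI.
Proof.
  intros H. unfold riesz_node. pose proof PI_RGT_0.
  assert (Hj : INR j + 1 <= INR n) by (rewrite <- S_INR; apply le_INR; lia).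
  pose proof (pos_INR j).
  split.
  - apply Rmult_lt_0_compat; [lra|apply Rdiv_lt_0_compat; lra].
  - replace ((2 * INR j + 1) * (PI / (2 * INR n))) with ((2 * INR j + 1) * PI / (2 * INR n))
      by (field; lra).
    apply Rmult_lt_reg_r with (2 * INR n); [lra|].
    unfold Rdiv. rewrite Rmult_assoc, Rinv_l by lra. nra.
Qed.

(** With a = m PI / (2n) the right side of [dirichlet_sum] is sin(m PI) = 0, while 0 < a < PI makes
    sin a positive. *)
Lemma sum_cos_riesz_node n m :
  (0 < m < 2 * n)%nat -> rsum n (fun j => cos (INR m * riesz_node n j)) = 0.
Proof.
  intros Hm. pose proof PI_RGT_0.
  assert (Hn : 0 < INR n) by (apply lt_0_INR; lia).
  assert (Hm1 : 0 < INR m) by (apply lt_0_INR; lia).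
  assert (Hm2 : INR m < 2 * INR n)
    by (replace 2 with (INR 2) by (simpl; lra); rewrite <- mult_INR; apply lt_INR; lia).
  set (a := INR m * (PI / (2 * INR n))).
  assert (Ha : 0 < sin a).
  { apply sin_gt_0; unfold a.
    - apply Rmult_lt_0_compat; [lra|apply Rdiv_lt_0_compat; lra].
    - replace (INR m * (PI / (2 * INR n))) with (INR m * PI / (2 * INR n)) by (field; lra).
      apply Rmult_lt_reg_r with (2 * INR n); [lra|].
      unfold Rdiv. rewrite Rmult_assoc, Rinv_l by lra. nra. }
  pose proof (dirichlet_sum n a) as D.
  assert (E : sin (2 * INR n * a) = 0).
  { apply sin_eq_0_1. exists (Z.of_nat m). rewrite <- INR_IZR_INZ. unfold a. field. lra. }
  rewrite E in D.
  rewrite (rsum_ext _ _ (fun j => cos ((2 * INR j + 1) * a)))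
    by (intros; f_equal; unfold a, riesz_node; ring).
  apply Rmult_integral in D. destruct D; [lra|assumption].
Qed.

Lemma sin_riesz_node n j : (0 < n)%nat -> sin (INR n * riesz_node n j) ^ 2 = 1.
Proof.
  intros Hn. assert (0 < INR n) by (apply lt_0_INR; lia).
  assert (C : cos (INR n * riesz_node n j) = 0).
  { apply cos_eq_0_1. exists (Z.of_nat j). rewrite <- INR_IZR_INZ.
    unfold riesz_node. field. lra. }
  pose proof (sin2_cos2 (INR n * riesz_node n j)) as S. rewrite C in S.
  unfold Rsqr in S. nra.
Qed.

Lemma sin_second_difference a b :
  sin (a + b) - 2 * sin a + sin (a - b) = - 4 * sin (b / 2) ^ 2 * sin a.
Proof.
  rewrite sin_plus, sin_minus.
  replace b with (2 * (b / 2)) at 1 3 by field. rewrite cos_2a_sin. ring.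
Qed.

(* M. Riesz: [W k] below has vanishing second differences for [0 < k < n] by
   orthogonality, so it is linear in [k]; [W n] is the total mass of the weights. *)
Lemma riesz_weights n : (0 < n)%nat ->
  exists w : nat -> R,
    (forall k, (k <= n)%nat -> rsum n (fun j => w j * sin (INR k * riesz_node n j)) = INR k) /\
    rsum n (fun j => Rabs (w j)) <= INR n.
Proof.
  intros Hn. assert (Hn0 : 0 < INR n) by (apply lt_0_INR; lia).
  set (phi := riesz_node n). set (N := INR n).
  (* These weights cancel the factor sin(phi/2)^2 produced by a second difference in k. *)
  set (lam := fun j => / sin (phi j / 2) ^ 2).
  assert (Hs : forall j, (j < n)%nat -> 0 < sin (phi j / 2)).
  { intros j Hj. destruct (riesz_node_bounds n j Hj) as [H1 H2]. fold (phi j) in H1, H2.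
    apply sin_gt_0; lra. }
  assert (Hlam : forall j, (j < n)%nat -> 0 < lam j)
    by (intros j Hj; apply Rinv_0_lt_compat, pow_lt, Hs, Hj).
  set (W := fun k : nat => rsum n (fun j => lam j * sin (N * phi j) * sin (INR k * phi j))).
  assert (W0 : W O = 0).
  { unfold W. rewrite (rsum_ext _ _ (fun _ => 0)); [rewrite rsum_const; lra|].
    intros. simpl. rewrite Rmult_0_l, sin_0. lra. }
  assert (Wrec : forall k, (S k < n)%nat -> W (S (S k)) = 2 * W (S k) - W k).
  { intros k Hk.
    enough (W (S (S k)) + (-2) * W (S k) + W k = 0) by lra.
    unfold W. rewrite <- rsum_scal, <- !rsum_plus.
    rewrite (rsum_ext _ _ (fun j => (-2) * cos (INR (n - S k) * phi j)
                                    + 2 * cos (INR (n + S k) * phi j))).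
    - rewrite rsum_plus, !rsum_scal. unfold phi.
      rewrite !sum_cos_riesz_node by lia. lra.
    - intros j Hj. pose proof (sin_second_difference (INR (S k) * phi j) (phi j)) as D.
      replace (INR (S k) * phi j + phi j) with (INR (S (S k)) * phi j) in D
        by (rewrite !S_INR; ring).
      replace (INR (S k) * phi j - phi j) with (INR k * phi j) in D
        by (rewrite !S_INR; ring).
      rewrite minus_INR, plus_INR by lia. fold N.
      rewrite Rmult_minus_distr_r, Rmult_plus_distr_r, cos_minus, cos_plus.
      transitivity (lam j * sin (N * phi j) * (- 4 * sin (phi j / 2) ^ 2 * sin (INR (S k) * phi j))).
      + rewrite <- D. ring.
      + unfold lam. field. specialize (Hs j Hj). lra. }
  assert (Wlin : forall k, (S k <= n)%nat -> W k = INR k * W 1%nat /\ W (S k) = INR (S k) * W 1%nat).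
  { induction k as [|k IH]; intros Hk.
    - rewrite W0. simpl. lra.
    - destruct IH as [I1 I2]; [lia|]. split; [exact I2|].
      rewrite Wrec by lia. rewrite I2, I1, !S_INR. ring. }
  assert (Wk : forall k, (k <= n)%nat -> W k = INR k * W 1%nat).
  { intros [|k] Hk; [rewrite W0; simpl; lra|apply Wlin; lia]. }
  assert (Wn : W n = rsum n lam).
  { unfold W. apply rsum_ext. intros j Hj. fold N.
    pose proof (sin_riesz_node n j Hn) as Hsq. fold (phi j) N in Hsq.
    replace (lam j * sin (N * phi j) * sin (N * phi j)) with (lam j * sin (N * phi j) ^ 2) by ring.
    rewrite Hsq. ring. }
  assert (Lpos : 0 < rsum n lam).
  { apply Rlt_le_trans with (lam O); [apply Hlam; lia|].
    apply rsum_term_le; [intros; left; auto|lia]. }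
  assert (W1 : 0 < W 1%nat).
  { pose proof (Wk n (Nat.le_refl n)) as E. rewrite Wn in E. fold N in E, Hn0. nra. }
  (* Dividing by [W 1] turns [W k = k W 1] into k and the total mass into [W n / W 1 = n]. *)
  exists (fun j => / W 1%nat * (lam j * sin (N * phi j))). split.
  - intros k Hk.
    rewrite (rsum_ext _ _ (fun j => / W 1%nat * (lam j * sin (N * phi j) * sin (INR k * phi j))))
      by (intros; unfold phi; ring).
    rewrite rsum_scal. fold (W k). rewrite (Wk k Hk). field. lra.
  - apply Rle_trans with (rsum n (fun j => / W 1%nat * lam j)).
    + apply rsum_le. intros j Hj.
      rewrite !Rabs_mult, (Rabs_right (/ W 1%nat)), (Rabs_right (lam j))
        by (apply Rle_ge; left; auto using Rinv_0_lt_compat).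
      apply Rmult_le_compat_l; [left; now apply Rinv_0_lt_compat|].
      rewrite <- (Rmult_1_r (lam j)) at 2. apply Rmult_le_compat_l; [left; auto|].
      apply Rabs_le. pose proof (SIN_bound (N * phi j)). lra.
    + rewrite rsum_scal, <- Wn, (Wk n (Nat.le_refl n)). fold N. right. field. lra.
Qed.

(** As an inductive predicate it reduces linear identities to the functions cos(k t); [cospoly_ext]
    stands in for functional extensionality. *)
Inductive cospoly (n : nat) : (R -> R) -> Prop :=
| cospoly_cos k : (k <= n)%nat -> cospoly n (fun t => cos (INR k * t))
| cospoly_lin a b f g : cospoly n f -> cospoly n g -> cospoly n (fun t => a * f t + b * g t)
| cospoly_ext f g : (forall t, f t = g t) -> cospoly n f -> cospoly n g.

Lemma cospoly_le n m f : (n <= m)%nat -> cospoly n f -> cospoly m f.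
Proof.
  intros H Hf. induction Hf as [k Hk|a b f g _ IHf _ IHg|f g E _ IH].
  - apply cospoly_cos. lia.
  - now apply cospoly_lin.
  - now apply cospoly_ext with f.
Qed.

Lemma cospoly_const n a : cospoly n (fun _ => a).
Proof.
  apply cospoly_ext with (fun t => a * cos (INR 0 * t) + 0 * cos (INR 0 * t)).
  - intros. simpl. rewrite Rmult_0_l, cos_0. ring.
  - apply cospoly_lin; apply cospoly_cos; lia.
Qed.

(** Product to sum: 2 cos t cos(k t) = cos((k+1) t) + cos((k-1) t). *)
Lemma cospoly_mul_cos n f : cospoly n f -> cospoly (S n) (fun t => cos t * f t).
Proof.
  intros Hf. induction Hf as [k Hk|a b f g _ IHf _ IHg|f g E _ IH].
  - destruct k as [|k].
    + apply cospoly_ext with (fun t => cos (INR 1 * t)); [|apply cospoly_cos; lia].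
      intros. simpl. rewrite Rmult_0_l, cos_0, Rmult_1_l. ring.
    + apply cospoly_ext with (fun t => /2 * cos (INR (S (S k)) * t) + /2 * cos (INR k * t)).
      * intros t. replace (INR (S (S k)) * t) with (INR (S k) * t + t) by (rewrite !S_INR; ring).
        replace (INR k * t) with (INR (S k) * t - t) by (rewrite !S_INR; ring).
        rewrite cos_plus, cos_minus. field.
      * apply cospoly_lin; apply cospoly_cos; lia.
  - apply cospoly_ext with (fun t => a * (cos t * f t) + b * (cos t * g t)).
    + intros. ring.
    + now apply cospoly_lin.
  - apply cospoly_ext with (fun t => cos t * f t); [intros; now rewrite E|assumption].
Qed.

Lemma cospoly_affine_pow a b m : cospoly m (fun t => (a + b * cos t) ^ m).
Proof.
  induction m as [|m IH]; [exact (cospoly_const 0 1)|].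
  apply cospoly_ext with (fun t => a * (a + b * cos t) ^ m + b * (cos t * (a + b * cos t) ^ m)).
  - intros. simpl. ring.
  - apply cospoly_lin.
    + apply cospoly_le with m; [lia|exact IH].
    + now apply cospoly_mul_cos.
Qed.

Lemma cospoly_rsum n m (F : nat -> R -> R) :
  (forall i, (i < m)%nat -> cospoly n (F i)) -> cospoly n (fun t => rsum m (fun i => F i t)).
Proof.
  induction m as [|m IH]; intros H; [exact (cospoly_const n 0)|].
  apply cospoly_ext with (fun t => 1 * rsum m (fun i => F i t) + 1 * F m t).
  - intros. simpl. ring.
  - apply cospoly_lin; [apply IH; intros; apply H; lia|apply H; lia].
Qed.

Lemma cospoly_scal n a f : cospoly n f -> cospoly n (fun t => a * f t).
Proof.
  intros H. apply cospoly_ext with (fun t => a * f t + 0 * f t); [intros; ring|].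
  now apply cospoly_lin.
Qed.

(** Both sides are linear in q. For q = cos(k t) the halved symmetric difference is - sin(k t) sin(k
    phi), so the weights return - k sin(k t). *)
Lemma cospoly_riesz n w q :
  (forall k, (k <= n)%nat -> rsum n (fun j => w j * sin (INR k * riesz_node n j)) = INR k) ->
  cospoly n q ->
  forall t, derivable_pt_lim q t
    (rsum n (fun j => w j * ((q (t + riesz_node n j) - q (t - riesz_node n j)) / 2))).
Proof.
  intros Hw Hq. induction Hq as [k Hk|a b f g _ IHf _ IHg|f g E _ IH]; intros t.
  - assert (D : derivable_pt_lim (fun t => cos (INR k * t)) t (- sin (INR k * t) * (INR k * 1))).
    { apply (derivable_pt_lim_comp (fun t => INR k * t) cos).
      - apply (derivable_pt_lim_scal id). apply derivable_pt_lim_id.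
      - apply derivable_pt_lim_cos. }
    replace (rsum _ _) with (- sin (INR k * t) * (INR k * 1)); [exact D|].
    transitivity (- sin (INR k * t) * rsum n (fun j => w j * sin (INR k * riesz_node n j)));
      [rewrite Hw by exact Hk; ring|].
    rewrite <- rsum_scal.
    apply rsum_ext. intros j _.
    rewrite Rmult_plus_distr_l, Rmult_minus_distr_l, cos_plus, cos_minus. field.
  - replace (rsum _ _) with
      (a * rsum n (fun j => w j * ((f (t + riesz_node n j) - f (t - riesz_node n j)) / 2))
       + b * rsum n (fun j => w j * ((g (t + riesz_node n j) - g (t - riesz_node n j)) / 2))).
    + apply (derivable_pt_lim_plus (fun t => a * f t) (fun t => b * g t));
        [apply (derivable_pt_lim_scal f)|apply (derivable_pt_lim_scal g)]; auto.
    + rewrite <- !rsum_scal, <- rsum_plus. apply rsum_ext. intros. field.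
  - replace (rsum _ _) with
      (rsum n (fun j => w j * ((f (t + riesz_node n j) - f (t - riesz_node n j)) / 2)))
      by (apply rsum_ext; intros; now rewrite !E).
    intros eps He. destruct (IH t eps He) as [dl Hd]. exists dl. intros. rewrite <- !E. auto.
Qed.

(** Riesz's formula, with weights of total mass at most n, bounds the derivative by n M; the mean
    value theorem does the rest. *)
Lemma cospoly_bernstein n q M :
  (0 < n)%nat -> cospoly n q -> (forall t, Rabs (q t) <= M) ->
  forall s t, Rabs (q s - q t) <= INR n * M * Rabs (s - t).
Proof.
  intros Hn Hq HM. destruct (riesz_weights n Hn) as [w [Hw Hm]].
  pose proof (cospoly_riesz n w q Hw Hq) as D.
  set (q' := fun t => rsum n (fun j => w j * ((q (t + riesz_node n j) - q (t - riesz_node n j)) / 2))) in D.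
  assert (HM0 : 0 <= M) by (pose proof (HM 0); pose proof (Rabs_pos (q 0)); lra).
  assert (B : forall t, Rabs (q' t) <= INR n * M).
  { intros t. unfold q'. eapply Rle_trans; [apply rsum_abs|].
    apply Rle_trans with (rsum n (fun j => M * Rabs (w j))).
    - apply rsum_le. intros j _. rewrite Rabs_mult, Rmult_comm.
      apply Rmult_le_compat_r; [apply Rabs_pos|].
      pose proof (HM (t + riesz_node n j)) as H1. pose proof (HM (t - riesz_node n j)) as H2.
      revert H1 H2. unfold Rabs. repeat destruct Rcase_abs; lra.
    - rewrite rsum_scal, (Rmult_comm (INR n)). now apply Rmult_le_compat_l. }
  assert (L : forall s t, s < t -> Rabs (q t - q s) <= INR n * M * (t - s)).
  { intros s t Hst. destruct (MVT_cor2 q q' s t Hst) as [c [Ec _]]; [intros; apply D|].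
    rewrite Ec, Rabs_mult, (Rabs_right (t - s)) by lra.
    apply Rmult_le_compat_r; [lra|apply B]. }
  intros s t. destruct (Rtotal_order s t) as [H|[->|H]].
  - rewrite Rabs_minus_sym, (Rabs_minus_sym s). rewrite (Rabs_right (t - s)) by lra. now apply L.
  - rewrite !Rminus_diag, Rabs_R0. lra.
  - rewrite (Rabs_right (s - t)) by lra. now apply L.
Qed.

(** From sin t >= t - t^3/6: the gap t (4 - t^2) / 6 is nonnegative because t <= PI/2 <= 2. *)
Lemma sin_ge_third t : 0 <= t <= PI / 2 -> t / 3 <= sin t.
Proof.
  intros [H0 H1]. pose proof PI_4. pose proof PI_RGT_0.
  destruct (sin_bound t 0) as [L _]; [lra|lra|].
  unfold sin_approx, sin_term in L. simpl in L.
  assert (0 <= t * (4 - t * t)) by (apply Rmult_le_pos; [lra|nra]). nra.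
Qed.

(** For t <= s the difference is -2 sin a sin m with a = (s-t)/2 and m = (s+t)/2. Since m lies in
    [a, PI - a], both sines are at least sin a >= (s-t)/6. *)
Lemma cos_diff_ge s t : 0 <= s <= PI -> 0 <= t <= PI -> (s - t) ^ 2 / 18 <= Rabs (cos s - cos t).
Proof.
  assert (G : forall s t, 0 <= t -> t <= s -> s <= PI -> (s - t) ^ 2 / 18 <= Rabs (cos s - cos t)).
  { clear. intros s t Ht Hts Hs. rewrite form2.
    set (a := (s - t) / 2). set (m := (s + t) / 2).
    assert (Ha : a / 3 <= sin a) by (apply sin_ge_third; unfold a; lra).
    assert (Hm : sin a <= sin m).
    { destruct (Rle_dec m (PI / 2)).
      - apply sin_incr_1; unfold a, m in *; lra.
      - rewrite <- (sin_PI_x m). apply sin_incr_1; unfold a, m in *; lra. }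
    assert (0 <= a) by (unfold a; lra).
    rewrite <- Rabs_Ropp, Rabs_right by nra.
    replace ((s - t) ^ 2 / 18) with (2 * (a / 3) * (a / 3)) by (unfold a; field).
    nra. }
  intros Hs Ht. destruct (Rle_dec t s).
  - apply G; lra.
  - rewrite Rabs_minus_sym. replace ((s - t) ^ 2) with ((t - s) ^ 2) by ring. apply G; lra.
Qed.

(* Under x = (1 + cos t) / 2 Bernstein's inequality becomes a 1/2-Hoelder bound on [0,1],
   with the factor n that makes degrees of order 1 / sqrt h admissible. *)
Lemma poly_holder n p M :
  (0 < n)%nat -> cospoly n (fun t => p ((1 + cos t) / 2)) ->
  (forall x, 0 <= x <= 1 -> Rabs (p x) <= M) ->
  forall x y, 0 <= x <= 1 -> 0 <= y <= 1 ->
    Rabs (p x - p y) <= 6 * INR n * M * sqrt (Rabs (x - y)).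
Proof.
  intros Hn Hp HM x y Hx Hy.
  set (s := acos (2 * x - 1)). set (t := acos (2 * y - 1)).
  assert (Hs : cos s = 2 * x - 1) by (apply cos_acos; lra).
  assert (Ht : cos t = 2 * y - 1) by (apply cos_acos; lra).
  pose proof (acos_bound (2 * x - 1)) as Bs. pose proof (acos_bound (2 * y - 1)) as Bt.
  fold s in Bs. fold t in Bt.
  assert (HM0 : 0 <= M) by (pose proof (HM x Hx); pose proof (Rabs_pos (p x)); lra).
  assert (B : Rabs (p x - p y) <= INR n * M * Rabs (s - t)).
  { replace x with ((1 + cos s) / 2) at 1 by (rewrite Hs; field).
    replace y with ((1 + cos t) / 2) at 1 by (rewrite Ht; field).
    apply (cospoly_bernstein n (fun t => p ((1 + cos t) / 2))); auto.
    intros u. apply HM. pose proof (COS_bound u). lra. }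
  pose proof (cos_diff_ge s t Bs Bt) as C. rewrite Hs, Ht in C.
  replace (2 * x - 1 - (2 * y - 1)) with (2 * (x - y)) in C by ring.
  rewrite Rabs_mult, (Rabs_right 2) in C by lra.
  (* [cos_diff_ge] gives (s-t)^2 / 18 <= 2 |x-y|, hence the constant 6 = sqrt 36. *)
  assert (Q : Rabs (s - t) <= 6 * sqrt (Rabs (x - y))).
  { rewrite <- (sqrt_Rsqr_abs (s - t)). replace 6 with (sqrt (6 * 6)) by (apply sqrt_square; lra).
    rewrite <- sqrt_mult by (try lra; apply Rabs_pos).
    apply sqrt_le_1_alt. unfold Rsqr. lra. }
  pose proof (pos_INR n). apply Rle_trans with (1 := B).
  replace (6 * INR n * M * sqrt (Rabs (x - y))) with (INR n * M * (6 * sqrt (Rabs (x - y)))) by ring.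
  apply Rmult_le_compat_l; [nra|exact Q].
Qed.

(** * Positive semidefinite kernels *)

Definition psd (k : point -> point -> R) : Prop := forall g, 0 <= comb_ip k g g.
Definition sym (k : point -> point -> R) : Prop := forall x y, k x y = k y x.

Definition comb_axpy (g : comb) (t : R) (h : comb) : comb :=
  mkComb (csize g + csize h)
    (fun i => if Nat.ltb i (csize g) then ccoef g i else t * ccoef h (i - csize g))
    (fun i => if Nat.ltb i (csize g) then cpt g i else cpt h (i - csize g)).

Definition comb_dirac (z : point) : comb := mkComb 1 (fun _ => 1) (fun _ => z).

(** Moves a factor phi(x) phi(y) of a kernel into the coefficients. *)
Definition comb_weight (phi : point -> R) (g : comb) : comb :=
  mkComb (csize g) (fun i => ccoef g i * phi (cpt g i)) (cpt g).

Lemma rsum_axpy g t h (F : R -> point -> R) :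
  rsum (csize (comb_axpy g t h)) (fun i => F (ccoef (comb_axpy g t h) i) (cpt (comb_axpy g t h) i))
  = rsum (csize g) (fun i => F (ccoef g i) (cpt g i))
    + rsum (csize h) (fun i => F (t * ccoef h i) (cpt h i)).
Proof.
  simpl. rewrite rsum_split. f_equal; apply rsum_ext; intros i Hi.
  - now rewrite (proj2 (Nat.ltb_lt i (csize g)) Hi).
  - replace (Nat.ltb (csize g + i) (csize g)) with false by (symmetry; apply Nat.ltb_ge; lia).
    now replace (csize g + i - csize g)%nat with i by lia.
Qed.

Lemma comb_ip_eval k g h : sym k ->
  comb_ip k g h = rsum (csize g) (fun i => ccoef g i * comb_eval k h (cpt g i)).
Proof.
  intros Hk. unfold comb_ip, comb_eval. apply rsum_ext. intros. rewrite <- rsum_scal.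
  apply rsum_ext. intros j _. rewrite (Hk (cpt h j)). ring.
Qed.

Lemma comb_ip_sym k g h : sym k -> comb_ip k g h = comb_ip k h g.
Proof.
  intros Hk. unfold comb_ip. rewrite rsum_exchange. apply rsum_ext. intros j _.
  apply rsum_ext. intros i _. rewrite (Hk (cpt g i)). ring.
Qed.

Lemma comb_ip_axpy_l k g t h e : sym k ->
  comb_ip k (comb_axpy g t h) e = comb_ip k g e + t * comb_ip k h e.
Proof.
  intros Hk. rewrite !comb_ip_eval by exact Hk.
  rewrite (rsum_axpy g t h (fun c p => c * comb_eval k e p)), <- rsum_scal.
  f_equal. apply rsum_ext. intros. ring.
Qed.

Lemma comb_ip_dirac k g z : comb_ip k g (comb_dirac z) = comb_eval k g z.
Proof. unfold comb_ip, comb_eval. apply rsum_ext. intros. simpl. ring. Qed.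

(** The squared norm of g + t h is a nonnegative quadratic in t; it is evaluated at its minimiser
    when the leading coefficient is positive. *)
Lemma comb_cauchy_schwarz k g h : sym k -> psd k ->
  comb_ip k g h ^ 2 <= comb_ip k g g * comb_ip k h h.
Proof.
  intros Hs Hp.
  assert (Q : forall t, 0 <= comb_ip k g g + 2 * t * comb_ip k g h + t ^ 2 * comb_ip k h h).
  { intros t. pose proof (Hp (comb_axpy g t h)) as P.
    rewrite comb_ip_axpy_l, (comb_ip_sym k g), (comb_ip_sym k h), !comb_ip_axpy_l,
      (comb_ip_sym k h g) in P by exact Hs. nra. }
  pose proof (Hp g) as Pg. pose proof (Hp h) as Ph.
  set (a := comb_ip k g g) in *. set (b := comb_ip k g h) in *. set (c := comb_ip k h h) in *.
  destruct (Rle_lt_or_eq_dec 0 c Ph) as [Hc|Hc].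
  - specialize (Q (- b / c)).
    replace (a + 2 * (- b / c) * b + (- b / c) ^ 2 * c) with ((a * c - b ^ 2) / c) in Q by (field; lra).
    assert (0 <= (a * c - b ^ 2) / c * c) by (apply Rmult_le_pos; lra).
    replace ((a * c - b ^ 2) / c * c) with (a * c - b ^ 2) in H by (field; lra). lra.
  - destruct (Req_dec b 0) as [->|Hb]; [nra|].
    (* With c = 0 and b nonzero the quadratic is affine and takes the value -1 at this t. *)
    specialize (Q (- (a + 1) / (2 * b))). rewrite <- Hc in Q.
    replace (a + 2 * (- (a + 1) / (2 * b)) * b + (- (a + 1) / (2 * b)) ^ 2 * 0) with (-1) in Q
      by (field; lra). lra.
Qed.

(** Evaluation at z is the inner product with k(z, .), whose squared norm is k(z, z). *)
Lemma comb_eval_bound k g z : sym k -> psd k ->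
  comb_eval k g z ^ 2 <= comb_ip k g g * k z z.
Proof.
  intros Hs Hp. rewrite <- comb_ip_dirac.
  replace (k z z) with (comb_ip k (comb_dirac z) (comb_dirac z))
    by (unfold comb_ip; simpl; ring).
  now apply comb_cauchy_schwarz.
Qed.

Lemma comb_ip_ext k k' g h : (forall x y, k x y = k' x y) -> comb_ip k g h = comb_ip k' g h.
Proof. intros E. unfold comb_ip. do 2 (apply rsum_ext; intros). now rewrite E. Qed.

Lemma comb_ip_plus k k' g h :
  comb_ip (fun x y => k x y + k' x y) g h = comb_ip k g h + comb_ip k' g h.
Proof.
  unfold comb_ip. rewrite <- rsum_plus. apply rsum_ext. intros. rewrite <- rsum_plus.
  apply rsum_ext. intros. ring.
Qed.

Lemma comb_ip_scal a k g h :
  comb_ip (fun x y => a * k x y) g h = a * comb_ip k g h.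
Proof.
  unfold comb_ip. rewrite <- rsum_scal. apply rsum_ext. intros. rewrite <- rsum_scal.
  apply rsum_ext. intros. ring.
Qed.

Lemma comb_ip_weight phi k g h :
  comb_ip k (comb_weight phi g) (comb_weight phi h)
  = comb_ip (fun x y => phi x * k x y * phi y) g h.
Proof. unfold comb_ip. do 2 (apply rsum_ext; intros). simpl. ring. Qed.

Lemma comb_ip_rsum d (K : nat -> point -> point -> R) g h :
  comb_ip (fun x y => rsum d (fun c => K c x y)) g h = rsum d (fun c => comb_ip (K c) g h).
Proof.
  induction d as [|d IH]; simpl.
  - unfold comb_ip. rewrite (rsum_ext _ _ (fun _ => 0)); [rewrite rsum_const; lra|].
    intros. rewrite (rsum_ext _ _ (fun _ => 0)); [rewrite rsum_const; lra|]. intros. ring.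
  - rewrite <- IH, <- comb_ip_plus. reflexivity.
Qed.

Lemma comb_ip_cv (K : nat -> point -> point -> R) k g h :
  (forall x y, Un_cv (fun N => K N x y) (k x y)) ->
  Un_cv (fun N => comb_ip (K N) g h) (comb_ip k g h).
Proof.
  intros H. unfold comb_ip. apply rsum_cv. intros i _. apply rsum_cv. intros j _.
  apply (CV_mult (fun _ => ccoef g i * ccoef h j) (fun N => K N (cpt g i) (cpt h j)));
    [apply Un_cv_const|apply H].
Qed.

Lemma psd_weight phi k : psd k -> psd (fun x y => phi x * k x y * phi y).
Proof. intros H g. rewrite <- comb_ip_weight. apply H. Qed.

Lemma psd_ext k k' : (forall x y, k x y = k' x y) -> psd k -> psd k'.
Proof. intros E H g. rewrite <- (comb_ip_ext k) by exact E. apply H. Qed.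

Definition dot (d : nat) (x y : point) : R := rsum d (fun i => x i * y i).

Lemma dot_sym d x y : dot d x y = dot d y x.
Proof. apply rsum_ext. intros. ring. Qed.

(** Induction on m: one factor of the dot product, expanded over coordinates c, makes the kernel a
    sum of the previous power weighted by x_c y_c. For m = 0 the form is the square of the sum of
    the coefficients. *)
Lemma psd_dot_pow d m : psd (fun x y => dot d x y ^ m).
Proof.
  induction m as [|m IH].
  - intros g. unfold comb_ip. simpl.
    rewrite (rsum_ext _ _ (fun i => rsum (csize g) (ccoef g) * ccoef g i)).
    + rewrite rsum_scal. apply Rle_0_sqr.
    + intros. rewrite Rmult_comm, <- rsum_scal. apply rsum_ext. intros. ring.
  - apply psd_ext with (fun x y => rsum d (fun c => x c * dot d x y ^ m * y c)).
    + intros x y. simpl. unfold dot at 2. rewrite Rmult_comm, <- rsum_scal.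
      apply rsum_ext. intros. ring.
    + intros g. rewrite (comb_ip_rsum d (fun c x y => x c * dot d x y ^ m * y c)).
      apply rsum_nonneg. intros c _. apply (psd_weight (fun x => x c)). exact IH.
Qed.

(** * Taylor tails of the exponential kernel *)

(** The sum has n + 1 terms, so n is the degree. *)
Definition taylor (n : nat) (s : R) : R := rsum (S n) (fun m => s ^ m / INR (fact m)).

Lemma taylor_cv s : Un_cv (fun n => taylor n s) (exp s).
Proof.
  apply Un_cv_ext with (E1 s); [|apply E1_cvg].
  intros n. unfold E1, taylor. induction n as [|n IH].
  - simpl. field.
  - cbn [sum_f_R0]. rewrite IH. cbn [rsum]. unfold Rdiv. ring.
Qed.

Lemma taylor_split n j s :
  taylor (n + j) s - taylor n s
  = rsum j (fun i => s ^ (S n + i) / INR (fact (S n + i))).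
Proof.
  unfold taylor. replace (S (n + j)) with (S n + j)%nat by lia. rewrite rsum_split. lra.
Qed.

Lemma Un_cv_shift u l n : Un_cv u l -> Un_cv (fun j => u (n + j)%nat) l.
Proof. intros H eps He. destruct (H eps He) as [N HN]. exists N. intros. apply HN. lia. Qed.

(** Put N = n + 1. For m >= N, s^m <= N^(-N) (N s)^m, so the tail is at most N^(-N) exp(N s). The
    comparison is made on finite blocks of terms and passed to the limit. *)
Lemma exp_tail_le n s : 0 <= s ->
  exp s - taylor n s <= exp (INR (S n) * s - INR (S n) * ln (INR (S n))).
Proof.
  intros Hs. set (N := INR (S n)).
  assert (HN : 1 <= N) by (unfold N; rewrite S_INR; pose proof (pos_INR n); lra).
  assert (E : exp (N * ln N) = N ^ S n).
  { rewrite <- Rpower_pow by lra. unfold Rpower. reflexivity. }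
  unfold Rminus at 2. rewrite exp_plus, exp_Ropp, E.
  set (q := / N ^ S n).
  assert (Hq : 0 < q) by (apply Rinv_0_lt_compat, pow_lt; lra).
  enough (0 <= exp (N * s) * q - (exp s - taylor n s)) by lra.
  apply Un_cv_ge with (fun j => taylor (n + j) (N * s) * q - (taylor (n + j) s - taylor n s)) O.
  - apply (CV_minus (fun j => taylor (n + j) (N * s) * q) (fun j => taylor (n + j) s - taylor n s)).
    + apply (CV_mult (fun j => taylor (n + j) (N * s)) (fun _ => q)); [|apply Un_cv_const].
      apply (Un_cv_shift (fun j => taylor j (N * s))), taylor_cv.
    + apply (CV_minus (fun j => taylor (n + j) s) (fun _ => taylor n s)); [|apply Un_cv_const].
      apply (Un_cv_shift (fun j => taylor j s)), taylor_cv.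
  - intros j _. rewrite taylor_split.
    assert (T0 : 0 <= taylor n (N * s)).
    { apply rsum_nonneg. intros. apply Rmult_le_pos; [apply pow_le; nra|].
      left. apply Rinv_0_lt_compat, INR_fact_lt_0. }
    assert (rsum j (fun i => s ^ (S n + i) / INR (fact (S n + i)))
            <= q * (taylor (n + j) (N * s) - taylor n (N * s))).
    { rewrite taylor_split, <- rsum_scal. apply rsum_le. intros i _.
      unfold Rdiv. rewrite <- Rmult_assoc.
      apply Rmult_le_compat_r; [left; apply Rinv_0_lt_compat, INR_fact_lt_0|].
      rewrite Rpow_mult_distr, <- Rmult_assoc, (pow_add N).
      unfold q. rewrite <- Rmult_assoc, Rinv_l, Rmult_1_l by (apply pow_nonzero; lra).
      rewrite <- (Rmult_1_l (s ^ (S n + i))) at 1.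
      apply Rmult_le_compat_r; [now apply pow_le|]. now apply pow_R1_Rle. }
    nra.
Qed.

Definition sdot (d : nat) (l : R) (x y : point) : R := dot d x y / l ^ 2.

Lemma sdot_sym d l x y : sdot d l x y = sdot d l y x.
Proof. unfold sdot. now rewrite dot_sym. Qed.

Lemma psd_taylor_diff d l n j : 0 < l ->
  psd (fun x y => taylor (n + j) (sdot d l x y) - taylor n (sdot d l x y)).
Proof.
  intros Hl.
  apply psd_ext with (fun x y => rsum j (fun i =>
    (/ (l ^ 2) ^ (S n + i) * / INR (fact (S n + i))) * dot d x y ^ (S n + i))).
  - intros x y. rewrite taylor_split. apply rsum_ext. intros i _. unfold sdot, Rdiv.
    rewrite Rpow_mult_distr, pow_inv. ring.
  - intros g. rewrite (comb_ip_rsum j (fun i x y =>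
      (/ (l ^ 2) ^ (S n + i) * / INR (fact (S n + i))) * dot d x y ^ (S n + i))).
    apply rsum_nonneg. intros i _. rewrite comb_ip_scal.
    apply Rmult_le_pos; [|apply psd_dot_pow].
    apply Rmult_le_pos; left; apply Rinv_0_lt_compat; [repeat apply pow_lt; lra|apply INR_fact_lt_0].
Qed.

Lemma psd_taylor d l n : 0 < l -> psd (fun x y => taylor n (sdot d l x y)).
Proof.
  intros Hl. apply psd_ext with (fun x y => dot d x y ^ 0 +
    (taylor (0 + n) (sdot d l x y) - taylor 0 (sdot d l x y))).
  - intros. unfold taylor at 2. simpl. field.
  - intros g. rewrite comb_ip_plus.
    apply Rplus_le_le_0_compat; [apply psd_dot_pow|now apply psd_taylor_diff].
Qed.

Definition exp_tail (d : nat) (l : R) (n : nat) (x y : point) : R :=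
  exp (sdot d l x y) - taylor n (sdot d l x y).

(** The tail is a pointwise limit of finite sums of positive semidefinite kernels, and nonnegativity
    of the form survives the limit. *)
Lemma psd_exp_tail d l n : 0 < l -> psd (exp_tail d l n).
Proof.
  intros Hl g.
  apply Un_cv_ge with (fun j => comb_ip (fun x y =>
     taylor (n + j) (sdot d l x y) - taylor n (sdot d l x y)) g g) O.
  - apply (comb_ip_cv (fun j x y => taylor (n + j) (sdot d l x y) - taylor n (sdot d l x y))).
    intros x y.
    apply (CV_minus (fun j => taylor (n + j) (sdot d l x y)) (fun _ => taylor n (sdot d l x y)));
      [|apply Un_cv_const].
    apply (Un_cv_shift (fun j => taylor j (sdot d l x y))), taylor_cv.
  - intros. now apply psd_taylor_diff.
Qed.

Lemma psd_exp d l : 0 < l -> psd (fun x y => exp (sdot d l x y)).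
Proof.
  intros Hl. apply psd_ext with (fun x y => taylor 0 (sdot d l x y) + exp_tail d l 0 x y).
  - intros. unfold exp_tail. ring.
  - intros g. rewrite comb_ip_plus.
    apply Rplus_le_le_0_compat; [now apply psd_taylor|now apply psd_exp_tail].
Qed.

Definition gauss (d : nat) (l : R) (x : point) : R := exp (- sdot d l x x / 2).

(** Expands |x-y|^2, reducing the kernel to the exponential of the scaled dot product, whose Taylor
    tails are positive semidefinite. *)
Lemma se_kernel_factor d l x y : 0 < l ->
  se_kernel d l x y = gauss d l x * exp (sdot d l x y) * gauss d l y.
Proof.
  intros Hl. unfold se_kernel, gauss. rewrite <- !exp_plus. f_equal.
  replace (sqdist d x y) with (dot d x x + -2 * dot d x y + dot d y y).
  - unfold sdot. field. lra.
  - unfold dot, sqdist. rewrite <- rsum_scal, <- !rsum_plus. apply rsum_ext. intros. ring.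
Qed.

Lemma psd_se_kernel d l : 0 < l -> psd (se_kernel d l).
Proof.
  intros Hl. eapply psd_ext; [intros; symmetry; now apply se_kernel_factor|].
  now apply psd_weight, psd_exp.
Qed.

Lemma se_kernel_sym d l : sym (se_kernel d l).
Proof.
  intros x y. unfold se_kernel. do 3 f_equal. unfold sqdist. apply rsum_ext. intros. ring.
Qed.

(** * A norming inequality for polynomials on the cube *)

Lemma exp_le_exp x y : x <= y -> exp x <= exp y.
Proof. intros [H| ->]; [left; now apply exp_increasing|right; reflexivity]. Qed.

Definition upd (c : point) (i : nat) (t : R) : point := fun j => if Nat.eqb j i then t else c j.

Lemma coord_le_edist d x y i : (i < d)%nat -> Rabs (x i - y i) <= edist d x y.
Proof.
  intros Hi. rewrite <- sqrt_Rsqr_abs. unfold edist. apply sqrt_le_1_alt.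
  rewrite Rsqr_pow2. unfold sqdist.
  apply (rsum_term_le d (fun i => (x i - y i) ^ 2)); [intros; apply pow2_ge_0|exact Hi].
Qed.

Section Norming.

Variables (d n : nat) (P : point -> R).
Hypothesis P_ext : forall x y, (forall i, (i < d)%nat -> x i = y i) -> P x = P y.
Hypothesis P_poly : forall c i, cospoly n (fun t => P (upd c i ((1 + cos t) / 2))).
Hypothesis n_pos : (0 < n)%nat.

(** The path from x to y changes one coordinate at a time and stays in the cube, so each of its d
    steps is a case of [poly_holder]. *)
Lemma cube_holder M h x y :
  (forall z, in_cube d z -> Rabs (P z) <= M) ->
  in_cube d x -> in_cube d y -> edist d x y <= h ->
  Rabs (P x - P y) <= INR d * (6 * INR n * M * sqrt h).
Proof.
  intros HM Hx Hy Hh.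
  set (H := fun k i => if Nat.ltb i k then y i else x i).
  assert (HM0 : 0 <= M) by (pose proof (HM x Hx); pose proof (Rabs_pos (P x)); lra).
  assert (E : P x - P y = - rsum d (fun k => P (H (S k)) - P (H k))).
  { rewrite (rsum_tele d (fun k => P (H k))).
    rewrite (P_ext (H d) y), (P_ext (H O) x); [ring|reflexivity|].
    intros i Hi. unfold H. now rewrite (proj2 (Nat.ltb_lt i d) Hi). }
  rewrite E, Rabs_Ropp, <- rsum_const. eapply Rle_trans; [apply rsum_abs|].
  apply rsum_le. intros k Hk. cbv beta.
  replace (P (H (S k))) with (P (upd (H k) k (y k))).
  2:{ apply P_ext. intros i _. unfold upd, H.
      destruct (Nat.eqb_spec i k) as [->|Hne].
      - now rewrite (proj2 (Nat.ltb_lt k (S k))) by lia.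
      - destruct (Nat.ltb_spec i k), (Nat.ltb_spec i (S k)); try lia; reflexivity. }
  replace (P (H k)) with (P (upd (H k) k (x k))).
  2:{ apply P_ext. intros i _. unfold upd, H.
      destruct (Nat.eqb_spec i k) as [->|Hne]; [|reflexivity].
      now rewrite Nat.ltb_irrefl. }
  destruct Hx as [Hx Hx'], Hy as [Hy Hy'].
  eapply Rle_trans; [apply (poly_holder n (fun t => P (upd (H k) k t)) M n_pos); auto|].
  - intros t Ht. apply HM. split; intros i Hi; unfold upd, H.
    + destruct (Nat.eqb_spec i k), (Nat.ltb_spec i k); auto.
    + destruct (Nat.eqb_spec i k); [lia|]. destruct (Nat.ltb_spec i k); auto.
  - apply Rmult_le_compat_l; [pose proof (pos_INR n); nra|].
    apply sqrt_le_1_alt. rewrite Rabs_minus_sym.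
    eapply Rle_trans; [now apply (coord_le_edist d)|exact Hh].
Qed.

(* The supremum M of |P| satisfies M <= mu + M / 2. *)
Lemma cube_norming A h mu :
  (forall z, in_cube d z -> Rabs (P z) <= A) ->
  6 * INR n * INR d * sqrt h <= / 2 ->
  (forall z, in_cube d z -> exists p, in_cube d p /\ edist d z p <= h /\ Rabs (P p) <= mu) ->
  forall z, in_cube d z -> Rabs (P z) <= 2 * mu.
Proof.
  intros HA Hh Hp z Hz.
  (* The a priori bound [A] makes the supremum finite, so that M / 2 can be absorbed into the left
     side. *)
  destruct (completeness (fun r => exists z, in_cube d z /\ r = Rabs (P z))) as [M [MU ML]].
  - exists A. intros r [y [Hy ->]]. auto.
  - exists (Rabs (P z)), z. auto.
  - assert (HM : forall y, in_cube d y -> Rabs (P y) <= M) by (intros y Hy; apply MU; eauto).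
    assert (M <= mu + M / 2).
    { apply ML. intros r [y [Hy ->]]. destruct (Hp y Hy) as [p [Cp [Ep Bp]]].
      pose proof (cube_holder M h y p HM Hy Cp Ep) as D.
      pose proof (Rabs_triang (P y - P p) (P p)) as T.
      replace (P y - P p + P p) with (P y) in T by ring.
      assert (0 <= M) by (pose proof (HM y Hy); pose proof (Rabs_pos (P y)); lra).
      assert (M * (6 * INR n * INR d * sqrt h) <= M * / 2) by now apply Rmult_le_compat_l.
      nra. }
    specialize (HM z Hz). lra.
Qed.

End Norming.

Lemma dot_upd d p c i t :
  dot d p (upd c i t) = dot d p (upd c i 0) + (if Nat.ltb i d then p i else 0) * t.
Proof.
  induction d as [|d IH]; [unfold dot; simpl; ring|].
  unfold dot in *. cbn [rsum]. rewrite IH. unfold upd.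
  destruct (Nat.eqb_spec d i) as [->|Hne].
  - rewrite Nat.ltb_irrefl. rewrite (proj2 (Nat.ltb_lt i (S i))) by lia. ring.
  - destruct (Nat.ltb_spec i d), (Nat.ltb_spec i (S d)); try lia; ring.
Qed.

(** Along a coordinate line the scaled dot product is affine in the coordinate, hence in cos t, and
    only its powers up to n occur. *)
Lemma cospoly_eval_taylor d l n g c i :
  cospoly n (fun t => comb_eval (fun p y => taylor n (sdot d l p y)) g (upd c i ((1 + cos t) / 2))).
Proof.
  unfold comb_eval. apply cospoly_rsum. intros j _. apply cospoly_scal.
  apply cospoly_rsum. intros m Hm. apply cospoly_le with m; [lia|].
  set (b := if Nat.ltb i d then cpt g j i else 0).
  apply cospoly_ext with (fun t => / INR (fact m) *
    ((dot d (cpt g j) (upd c i 0) + b / 2) / l ^ 2 + b / 2 / l ^ 2 * cos t) ^ m).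
  - intros t. unfold sdot. rewrite (dot_upd d _ c i ((1 + cos t) / 2)). fold b.
    replace ((dot d (cpt g j) (upd c i 0) + b * ((1 + cos t) / 2)) / l ^ 2)
      with ((dot d (cpt g j) (upd c i 0) + b / 2) / l ^ 2 + b / 2 / l ^ 2 * cos t)
      by (unfold Rdiv; ring).
    apply Rmult_comm.
  - apply cospoly_scal, cospoly_affine_pow.
Qed.

Lemma sdot_diag_bounds d l z : 0 < l -> in_cube d z -> 0 <= sdot d l z z <= INR d / l ^ 2.
Proof.
  intros Hl [Hz _]. unfold sdot.
  assert (0 < / l ^ 2) by now apply Rinv_0_lt_compat, pow_lt.
  assert (0 <= dot d z z <= INR d).
  { split.
    - apply rsum_nonneg. intros. apply Rle_0_sqr.
    - replace (INR d) with (rsum d (fun _ => 1)) by (rewrite rsum_const; ring).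
      apply rsum_le. intros i Hi. specialize (Hz i Hi). nra. }
  unfold Rdiv. split; [apply Rmult_le_pos; lra|apply Rmult_le_compat_r; lra].
Qed.

Lemma taylor_le n s t : 0 <= s <= t -> taylor n s <= taylor n t.
Proof.
  intros H. apply rsum_le. intros m _. apply Rmult_le_compat_r.
  - left. apply Rinv_0_lt_compat, INR_fact_lt_0.
  - now apply pow_incr.
Qed.

Lemma comb_eval_exp_split d l n g y :
  comb_eval (fun p y => exp (sdot d l p y)) g y
  = comb_eval (fun p y => taylor n (sdot d l p y)) g y + comb_eval (exp_tail d l n) g y.
Proof.
  unfold comb_eval. rewrite <- rsum_plus. apply rsum_ext. intros. unfold exp_tail. ring.
Qed.

Lemma comb_eval_se_kernel d l g y : 0 < l ->
  comb_eval (se_kernel d l) g y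
  = gauss d l y * comb_eval (fun p y => exp (sdot d l p y)) (comb_weight (gauss d l) g) y.
Proof.
  intros Hl. unfold comb_eval. rewrite <- rsum_scal. apply rsum_ext. intros. simpl.
  rewrite se_kernel_factor by exact Hl. ring.
Qed.

Lemma sqr_le_Rabs a r : 0 <= r -> a ^ 2 <= r ^ 2 -> Rabs a <= r.
Proof.
  intros Hr H. rewrite <- (Rabs_right r) by lra. apply Rsqr_le_abs_0. now rewrite !Rsqr_pow2.
Qed.

(** The bound of [exp_tail_le] at d / l^2, which bounds the scaled squared norm on the cube. *)
Definition tail_bound (d : nat) (l : R) (n : nat) : R :=
  exp (INR (S n) * (INR d / l ^ 2) - INR (S n) * ln (INR (S n))).

(* After multiplication by exp(|y|^2 / (2 l^2)), a kernel combination is its degree-n Taylor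
   polynomial plus a tail lying in the RKHS of the tail kernel; the polynomial is of the size
   of the tail at the zeros, hence everywhere. *)
Lemma sampling_inequality d l n g h :
  0 < l -> (0 < n)%nat -> 6 * INR n * INR d * sqrt h <= / 2 ->
  (forall y, in_cube d y ->
     exists p, in_cube d p /\ edist d y p <= h /\ comb_eval (se_kernel d l) g p = 0) ->
  forall z, in_cube d z ->
    comb_eval (se_kernel d l) g z ^ 2 <= 9 * tail_bound d l n * comb_ip (se_kernel d l) g g.
Proof.
  intros Hl Hn Hh Hz0 z Hz.
  set (g' := comb_weight (gauss d l) g).
  set (kT := fun p y => taylor n (sdot d l p y)).
  set (kE := fun p y => exp (sdot d l p y)).
  set (N2 := comb_ip (se_kernel d l) g g).
  assert (symT : sym kT) by (intros p q; unfold kT; now rewrite sdot_sym).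
  assert (symR : sym (exp_tail d l n)) by (intros p q; unfold exp_tail; now rewrite sdot_sym).
  assert (psdT : psd kT) by now apply psd_taylor.
  assert (psdR : psd (exp_tail d l n)) by now apply psd_exp_tail.
  (* The squared norm splits into a polynomial and a tail part, both nonnegative, so the tail part
     is at most [N2]. *)
  assert (HN : N2 = comb_ip kT g' g' + comb_ip (exp_tail d l n) g' g').
  { unfold N2, g'. rewrite <- comb_ip_plus, comb_ip_weight. apply comb_ip_ext.
    intros p q. rewrite se_kernel_factor by exact Hl. unfold kT, exp_tail. ring. }
  assert (HN0 : 0 <= N2) by now apply psd_se_kernel.
  assert (HT : 0 < tail_bound d l n) by apply exp_pos.
  set (r := sqrt (tail_bound d l n * N2)).
  assert (Hr0 : 0 <= r) by apply sqrt_pos.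
  assert (Hr : r ^ 2 = tail_bound d l n * N2)
    by (unfold r; rewrite pow2_sqrt; [reflexivity|apply Rmult_le_pos; lra]).
  assert (BR : forall y, in_cube d y -> Rabs (comb_eval (exp_tail d l n) g' y) <= r).
  { intros y Hy. apply sqr_le_Rabs; [exact Hr0|]. rewrite Hr.
    eapply Rle_trans; [now apply comb_eval_bound|].
    destruct (sdot_diag_bounds d l y Hl Hy) as [S0 S1].
    assert (exp_tail d l n y y <= tail_bound d l n).
    { eapply Rle_trans; [now apply exp_tail_le|]. unfold tail_bound.
      apply exp_le_exp. apply Rplus_le_compat_r. apply Rmult_le_compat_l; [apply pos_INR|exact S1]. }
    assert (0 <= exp_tail d l n y y).
    { specialize (psdR (comb_dirac y)). unfold comb_ip in psdR. simpl in psdR. lra. }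
    specialize (psdR g'). specialize (psdT g'). nra. }
  assert (BP : forall y, in_cube d y -> Rabs (comb_eval kT g' y) <= 2 * r).
  (* The choice of [A] comes from |v| <= 1 + v^2 and [comb_eval_bound]. *)
  { apply (cube_norming d n (comb_eval kT g')) with
      (A := 1 + comb_ip kT g' g' * taylor n (INR d / l ^ 2)) (h := h).
    - intros x y E. unfold comb_eval, kT, sdot. apply rsum_ext. intros i _. do 3 f_equal.
      apply rsum_ext. intros j Hj. now rewrite E.
    - intros. apply cospoly_eval_taylor.
    - exact Hn.
    - intros y Hy. pose proof (comb_eval_bound kT g' y symT psdT) as Bd.
      pose proof (taylor_le n _ _ (sdot_diag_bounds d l y Hl Hy)) as Tm.
      pose proof (psdT g') as P0. fold (kT y y) in Tm.
      set (v := comb_eval kT g' y) in *.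
      assert (comb_ip kT g' g' * kT y y <= comb_ip kT g' g' * taylor n (INR d / l ^ 2))
        by now apply Rmult_le_compat_l.
      pose proof (Rabs_pos v). rewrite <- (pow2_abs v) in Bd. nra.
    - exact Hh.
    (* The Gaussian factor is positive, so at a zero of the kernel combination the polynomial equals
       minus the tail. *)
    - intros y Hy. destruct (Hz0 y Hy) as [p [Cp [Ep Zp]]]. exists p. repeat split; try apply Cp; auto.
      rewrite comb_eval_se_kernel in Zp by exact Hl. fold g' kE in Zp.
      pose proof (exp_pos (- sdot d l p p / 2)) as Gp.
      apply Rmult_integral in Zp. destruct Zp as [Zp|Zp]; [unfold gauss in Zp; lra|].
      unfold kE in Zp. rewrite (comb_eval_exp_split d l n) in Zp. fold kT in Zp.
      replace (comb_eval kT g' p) with (- comb_eval (exp_tail d l n) g' p) by lra.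
      rewrite Rabs_Ropp. auto. }
  rewrite comb_eval_se_kernel, (comb_eval_exp_split d l n) by exact Hl. fold g' kT.
  pose proof (BR z Hz) as Rz. pose proof (BP z Hz) as Pz.
  set (u := comb_eval kT g' z) in *. set (v := comb_eval (exp_tail d l n) g' z) in *.
  assert (G : 0 <= gauss d l z <= 1).
  { split; [left; apply exp_pos|]. rewrite <- exp_0. apply exp_le_exp.
    pose proof (sdot_diag_bounds d l z Hl Hz). lra. }
  (* 2 r from the polynomial and r from the tail; squaring gives the factor 9. *)
  assert (Rabs (u + v) <= 3 * r) by (pose proof (Rabs_triang u v); lra).
  replace (9 * tail_bound d l n * N2) with ((3 * r) ^ 2) by (rewrite Rpow_mult_distr, Hr; ring).
  rewrite <- (pow2_abs (gauss d l z * (u + v))). apply pow_incr. split; [apply Rabs_pos|].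
  rewrite Rabs_mult, (Rabs_right (gauss d l z)) by lra.
  pose proof (Rabs_pos (u + v)). nra.
Qed.

(** * Posterior mean and variance *)

(** For the approximating combinations this is Cauchy-Schwarz, the functional being the inner
    product with e; pointwise convergence at the centres of e carries it to g. *)
Lemma in_ball_functional d k B g e :
  sym k -> psd k -> in_ball_RKHS d k B g ->
  (forall i, (i < csize e)%nat -> in_cube d (cpt e i)) ->
  Rabs (rsum (csize e) (fun i => ccoef e i * g (cpt e i))) <= B * sqrt (comb_ip k e e).
Proof.
  intros Hs Hp [G [_ [_ [Hcv Hnorm]]]] He.
  set (s := sqrt (comb_ip k e e)). assert (Hs0 : 0 <= s) by apply sqrt_pos.
  assert (C : Un_cv (fun m => comb_ip k e (G m)) (rsum (csize e) (fun i => ccoef e i * g (cpt e i)))).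
  { apply Un_cv_ext with (fun m => rsum (csize e) (fun i => ccoef e i * comb_eval k (G m) (cpt e i))).
    - intros. now rewrite comb_ip_eval.
    - apply rsum_cv. intros i Hi.
      apply (CV_mult (fun _ => ccoef e i) (fun m => comb_eval k (G m) (cpt e i)));
        [apply Un_cv_const|now apply Hcv, He]. }
  apply cv_cvabs in C. apply le_epsilon. intros eps Heps.
  (* Dividing by s + 1 instead of s also covers s = 0. *)
  destruct (Hnorm (eps / (s + 1))) as [N0 HN]; [apply Rdiv_lt_0_compat; lra|].
  assert (Q : eps / (s + 1) * s <= eps).
  { replace (eps / (s + 1) * s) with (eps - eps / (s + 1)) by (field; lra).
    assert (0 < eps / (s + 1)) by (apply Rdiv_lt_0_compat; lra). lra. }
  set (v := Rabs _) in *.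
  enough (0 <= (B + eps / (s + 1)) * s - v) by lra.
  eapply (Un_cv_ge _ _ _ N0); [apply CV_minus; [apply (Un_cv_const ((B + eps / (s + 1)) * s))|exact C]|].
  intros m Hm. cbv beta. specialize (HN m Hm).
  set (a := comb_ip k (G m) (G m)) in *.
  assert (0 <= a) by apply Hp. pose proof (sqrt_pos a).
  assert (Rabs (comb_ip k e (G m)) <= s * sqrt a).
  { apply sqr_le_Rabs; [nra|]. rewrite Rpow_mult_distr. unfold s.
    rewrite !pow2_sqrt by (try apply Hp; lra). now apply comb_cauchy_schwarz. }
  nra.
Qed.

(** The function k(z, .) - sum_j beta_j k(x_j, .). When K beta = k(z), it is k(z, .) minus its
    orthogonal projection onto the span of the k(x_j, .). *)
Definition residual (n : nat) (x : nat -> point) (z : point) (beta : nat -> R) : comb :=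
  comb_axpy (comb_dirac z) (-1) (mkComb n beta x).

Lemma residual_functional n x z beta (F : point -> R) :
  rsum (csize (residual n x z beta))
    (fun i => ccoef (residual n x z beta) i * F (cpt (residual n x z beta) i))
  = F z - rsum n (fun j => beta j * F (x j)).
Proof.
  unfold residual. rewrite (rsum_axpy _ _ _ (fun c p => c * F p)). cbn [csize ccoef cpt comb_dirac rsum].
  rewrite (rsum_ext n _ (fun j => -1 * (beta j * F (x j)))) by (intros; ring).
  rewrite rsum_scal. ring.
Qed.

Section Posterior.

Variables (k : point -> point -> R) (n : nat) (x : nat -> point) (z : point) (beta : nat -> R).
Hypothesis k_sym : sym k.
Hypothesis beta_spec :
  forall i, (i < n)%nat -> rsum n (fun j => k (x i) (x j) * beta j) = k z (x i).

Lemma residual_eval y :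
  comb_eval k (residual n x z beta) y = k z y - rsum n (fun j => k y (x j) * beta j).
Proof.
  unfold comb_eval. rewrite (residual_functional n x z beta (fun p => k p y)). f_equal.
  apply rsum_ext. intros. rewrite (k_sym y). ring.
Qed.

Lemma residual_eval_node i : (i < n)%nat -> comb_eval k (residual n x z beta) (x i) = 0.
Proof. intros Hi. rewrite residual_eval, beta_spec by exact Hi. ring. Qed.

(** The residual vanishes at every data point, so pairing it with itself leaves only its value at
    z. *)
Lemma residual_norm :
  comb_ip k (residual n x z beta) (residual n x z beta)
  = k z z - rsum n (fun j => k z (x j) * beta j).
Proof.
  rewrite comb_ip_eval by exact k_sym.
  rewrite (residual_functional n x z beta (comb_eval k (residual n x z beta))).
  rewrite (rsum_ext n _ (fun _ => 0)).
  - rewrite rsum_const, residual_eval. ring.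
  - intros. rewrite residual_eval_node by assumption. ring.
Qed.

(** Symmetry of the Gram matrix: both sides equal beta^T K alpha. *)
Lemma post_mean_dual y alpha :
  (forall i, (i < n)%nat -> rsum n (fun j => k (x i) (x j) * alpha j) = y i) ->
  rsum n (fun j => k z (x j) * alpha j) = rsum n (fun j => beta j * y j).
Proof.
  intros Ha.
  rewrite (rsum_ext n _ (fun j => rsum n (fun i => k (x j) (x i) * beta i * alpha j))).
  - rewrite rsum_exchange. apply rsum_ext. intros i Hi. rewrite <- Ha by exact Hi.
    rewrite <- rsum_scal. apply rsum_ext. intros. rewrite (k_sym (x i)). ring.
  - intros j Hj. rewrite <- beta_spec, Rmult_comm, <- rsum_scal by exact Hj.
    apply rsum_ext. intros. ring.
Qed.

End Posterior.

(** * Fill distance and choice of the polynomial degree *)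

Lemma fill_distance_cover d n x h :
  is_fill_distance d n x h -> forall z, in_cube d z -> exists i, (i < n)%nat /\ edist d z (x i) <= h.
Proof.
  intros [U L] z Hz. destruct n as [|n].
  (* Without data points the set is empty, every real is an upper bound, and no least one exists. *)
  - assert (h <= h - 1); [|lra]. apply L. intros r [y [_ [[i [Hi _]] _]]]. lia.
  - assert (Mn : exists i, (i < S n)%nat /\
      forall j, (j < S n)%nat -> edist d z (x i) <= edist d z (x j)).
    { clear. induction n as [|n [i [Hi Hm]]].
      - exists O. split; [lia|]. intros j Hj. replace j with O by lia. lra.
      - destruct (Rle_dec (edist d z (x i)) (edist d z (x (S n)))).
        + exists i. split; [lia|]. intros j Hj.
          destruct (Nat.eq_dec j (S n)) as [->|]; [assumption|apply Hm; lia].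
        + exists (S n). split; [lia|]. intros j Hj.
          destruct (Nat.eq_dec j (S n)) as [->|]; [lra|].
          specialize (Hm j ltac:(lia)). lra. }
    destruct Mn as [i [Hi Hm]]. exists i. split; [exact Hi|]. apply U. exists z. eauto 6.
Qed.

Lemma nat_floor v : 1 <= v -> exists n, (0 < n)%nat /\ INR n <= v < INR (S n).
Proof.
  intros Hv. destruct (archimed v) as [A1 A2].
  assert (2 <= up v)%Z.
  { apply Z.lt_succ_r. apply lt_IZR. rewrite succ_IZR. lra. }
  exists (Z.to_nat (up v - 1)). split; [lia|].
  rewrite S_INR, INR_IZR_INZ, Z2Nat.id, minus_IZR by lia. lra.
Qed.

(** The degree is the integer part of v = 1 / (12 d sqrt h), the largest one the norming inequality
    admits. With N = n + 1 > v the tail decays like exp(-N (ln N - d / l^2)), and ln N is about half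
    of -ln h. *)
Lemma choose_degree d l : (1 <= d)%nat -> 0 < l ->
  exists h0, 0 < h0 /\ forall h, 0 < h -> h < h0 ->
  exists n, (0 < n)%nat /\ 6 * INR n * INR d * sqrt h <= / 2 /\
    6 * sqrt (tail_bound d l n) <= exp (/ (96 * INR d) * ln h / (2 * sqrt h)).
Proof.
  intros Hd Hl. set (D := INR d). set (S0 := D / l ^ 2).
  assert (HD : 1 <= D) by (change 1 with (INR 1); now apply le_INR).
  assert (HS : 0 <= S0) by (apply Rmult_le_pos; [lra|left; now apply Rinv_0_lt_compat, pow_lt]).
  (* With L = -ln h, the first summand forces ln N - S0 >= L / 4. The second makes L >= 48, so that
     half of the exponent v L / 4 absorbs the factor 36 = 6^2. *)
  exists (exp (- (4 * (12 * D + S0) + 576 * D))). split; [apply exp_pos|].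
  intros h Hh Hh0. set (L := - ln h).
  assert (HL : 4 * (12 * D + S0) + 576 * D < L).
  { apply ln_increasing in Hh0; [|exact Hh]. rewrite ln_exp in Hh0. unfold L. lra. }
  set (q := sqrt h). assert (Hq : 0 < q) by now apply sqrt_lt_R0.
  assert (Elq : ln q = - L / 2).
  { assert (ln h = ln q + ln q) by (rewrite <- ln_mult by exact Hq; f_equal; symmetry; apply sqrt_sqrt; lra).
    unfold L. lra. }
  assert (HDq : 0 < 12 * D * q) by nra.
  set (v := / (12 * D * q)).
  assert (Elv : ln v = L / 2 - ln (12 * D)).
  { unfold v. rewrite ln_Rinv, ln_mult by (try assumption; lra). lra. }
  assert (Hln : ln (12 * D) <= 12 * D).
  { pose proof (exp_ineq1_le (ln (12 * D))) as I. rewrite exp_ln in I by lra. lra. }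
  assert (Hv0 : 0 < v) by now apply Rinv_0_lt_compat.
  assert (Hv : 1 <= v).
  { left. apply ln_lt_inv; [lra|exact Hv0|]. rewrite ln_1. lra. }
  destruct (nat_floor v Hv) as [n [Hn [Hn1 Hn2]]].
  exists n. split; [exact Hn|]. split.
  - assert (INR n * (12 * D * q) <= v * (12 * D * q)) by (apply Rmult_le_compat_r; lra).
    replace (v * (12 * D * q)) with 1 in H by (unfold v; field; lra). lra.
  - set (N := INR (S n)) in *.
    assert (HlnN : L / 4 <= ln N - S0).
    { assert (ln v <= ln N) by (left; now apply ln_increasing). lra. }
    assert (K : v * (L / 4) <= N * (ln N - S0)) by (apply Rmult_le_compat; lra).
    assert (HqL : 6 <= / 8 * v * L).
    { assert (1 * L <= v * L) by (apply Rmult_le_compat_r; lra). lra. }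
    (* exp(3/2) >= 5/2, whose square exceeds 6. *)
    assert (E36 : 36 <= exp 6).
    { replace 6 with (3 / 2 + 3 / 2 + (3 / 2 + 3 / 2)) by field. rewrite !exp_plus.
      pose proof (exp_ineq1_le (3 / 2)).
      assert (6 <= exp (3 / 2) * exp (3 / 2)) by nra. nra. }
    (* Both sides are squared to remove the root of the tail bound. *)
    apply Rsqr_incr_0_var; [|left; apply exp_pos].
    unfold Rsqr. rewrite <- exp_plus.
    replace (6 * sqrt (tail_bound d l n) * (6 * sqrt (tail_bound d l n)))
      with (36 * (sqrt (tail_bound d l n) * sqrt (tail_bound d l n))) by ring.
    rewrite sqrt_sqrt by (left; apply exp_pos). unfold tail_bound. fold D S0 N.
    replace (/ (96 * D) * ln h / (2 * q) + / (96 * D) * ln h / (2 * q)) with (- / 8 * v * L)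
      by (unfold v, L; field; lra).
    apply Rle_trans with (exp 6 * exp (N * S0 - N * ln N)).
    + apply Rmult_le_compat_r; [left; apply exp_pos|exact E36].
    + rewrite <- exp_plus. apply exp_le_exp. lra.
Qed.

(** * The regret bound *)

Theorem theorem8 :
  forall (d : nat) (l : R), (1 <= d)%nat -> 0 < l ->
  exists c : R, 0 < c /\ exists h0 : R, 0 < h0 /\
  forall (B : R) (n : nat) (x : nat -> point) (f : nat -> point -> R)
         (m s2 : point -> R) (xT : point) (h : R),
    0 < B ->
    (forall i, (i < n)%nat -> in_cube d (x i)) ->
    (forall i j, (i < n)%nat -> (j < n)%nat -> x i = x j -> i = j) ->
    (forall i, (i < n)%nat -> in_ball_RKHS d (se_kernel d l) B (f i)) ->
    post_mean (se_kernel d l) n x (fun i => f i (x i)) m ->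
    post_var (se_kernel d l) n x s2 ->
    in_cube d xT ->
    (forall z, in_cube d z -> m z + B * sqrt (s2 z) <= m xT + B * sqrt (s2 xT)) ->
    is_fill_distance d n x h ->
    0 < h -> h < h0 ->
    simple_regret_le d (se_kernel d l) B n x f xT
      (B * exp (c * ln h / (2 * sqrt h))).
Proof.
  intros d l Hd Hl.
  assert (HD : 1 <= INR d) by (change 1 with (INR 1); now apply le_INR).
  (* 1/96 = 1/8 * 1/12: the squared bound decays with exponent v L / 8, where v = 1 / (12 d sqrt
     h). *)
  exists (/ (96 * INR d)). split; [apply Rinv_0_lt_compat; lra|].
  destruct (choose_degree d l Hd Hl) as [h0 [Hh0 Hdeg]]. exists h0. split; [exact Hh0|].
  intros B n x f m s2 xT h HB Hx _ _ [alpha [Ha Hm]] Hvar HxT Hmax Hfill Hh Hlt.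
  pose proof (se_kernel_sym d l) as Hs. pose proof (psd_se_kernel d l Hl) as Hp.
  set (k := se_kernel d l) in *.
  (* The minimum over rounds is bounded by its last term: index n is round T, where the queried
     point is [xT]. *)
  exists n. split; [lia|]. intros g Hg Hgx z Hz. rewrite Nat.ltb_irrefl.
  assert (Err : forall y, in_cube d y -> Rabs (g y - m y) <= B * sqrt (s2 y)).
  { intros y Hy. destruct (Hvar y) as [beta [Hb Es]].
    rewrite Es, <- (residual_norm k n x y beta Hs Hb).
    rewrite Hm, (post_mean_dual k n x y beta Hs Hb _ alpha Ha).
    (* Since g interpolates the data, g(y) - m(y) is the residual at y, as a functional, applied to
       g. *)
    rewrite (rsum_ext n _ (fun j => beta j * g (x j))) by (intros; now rewrite Hgx).
    rewrite <- residual_functional.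
    apply (in_ball_functional d); [exact Hs|exact Hp|exact Hg|].
    intros i Hi. simpl in *. destruct i; [exact Hy|]. simpl. apply Hx. lia. }
  destruct (Hdeg h Hh Hlt) as [N [HN [Hsmall Htail]]].
  assert (Hvb : sqrt (s2 xT) <= 3 * sqrt (tail_bound d l N)).
  { destruct (Hvar xT) as [beta [Hb Es]].
    (* [s2 xT] is both the value at [xT] and the squared norm of the residual, so the sampling
       inequality is quadratic on the left and linear on the right. *)
    assert (Q : s2 xT ^ 2 <= 9 * tail_bound d l N * s2 xT).
    { rewrite Es at 2. rewrite <- (residual_norm k n x xT beta Hs Hb).
      rewrite Es, <- (residual_eval k n x xT beta Hs).
      apply (sampling_inequality d l N _ h); auto.
      intros y Hy. destruct (fill_distance_cover d n x h Hfill y Hy) as [i [Hi Hd']].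
      exists (x i). split; [auto|]. split; [exact Hd'|].
      exact (residual_eval_node k n x xT beta Hs Hb i Hi). }
    replace 3 with (sqrt (3 * 3)) by (apply sqrt_square; lra).
    assert (0 < tail_bound d l N) by apply exp_pos.
    rewrite <- sqrt_mult by lra. apply sqrt_le_1_alt. nra. }
  (* g(z) - g(xT) <= m(z) + B sigma(z) - m(xT) + B sigma(xT) <= 2 B sigma(xT), which is at most 6 B
     times the root of the tail bound. *)
  pose proof (Err z Hz) as E1'. pose proof (Err xT HxT) as E2. pose proof (Hmax z Hz) as E3.
  pose proof (Rle_abs (g z - m z)). pose proof (Rle_abs (- (g xT - m xT))) as E4.
  rewrite Rabs_Ropp in E4.
  assert (B * (2 * sqrt (s2 xT)) <= B * exp (/ (96 * INR d) * ln h / (2 * sqrt h)))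
    by (apply Rmult_le_compat_l; lra).
  lra.
Qed.
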